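(* Let $V$ be a countable set and $A=(A_{vw})_{v,w\in V}$ a cofinal non-negative matrix over $V$ without zero rows, all of whose powers $A^n$ have finite entries, and such that $\beta_0<\infty$ if $NW\neq\emptyset$. Let $\beta\in\mathbb R$ and $v_0\in V$. Assume that $\sum_{n=0}^{\infty} A^n_{vw}e^{-n\beta}<\infty$ for all $v,w\in V$. Let $\psi$ be a non-zero $\beta$-harmonic vector with $\psi_{v_0}=1$ which is extremal, i.e. an extreme point of $E(A,\beta)_{v_0}$. Then there is an infinite path $t=(t_i)_{i=1}^\infty\in P(V)$ such that $t_1=v_0$, $t_i\neq t_j$ whenever $i\neq j$, and $$\psi_v=\lim_{k\to\infty}\frac{\sum_{n=0}^{\infty}A^n_{vt_k}e^{-n\beta}}{\sum_{n=0}^{\infty}A^n_{v_0t_k}e^{-n\beta}}$$ for all $v\in V$.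
   Context: Graph: $G$ is the directed graph with vertex set $V$ and exactly one edge from $v$ to $w$ if $A_{vw}\neq 0$ (none otherwise); $E$ is its edge set; $s(\mu),r(\mu)$ denote the initial and terminal vertex of an edge or finite path $\mu$ (finite paths have length at least $1$). $V_\infty=\{v\in V: \#s^{-1}(v)\in\{0,\infty\}\}$. A subset $H\subseteq V$ is hereditary if $e\in E$, $s(e)\in H$ imply $r(e)\in H$, and saturated if $v\in V\setminus V_\infty$, $r(s^{-1}(v))\subseteq H$ imply $v\in H$. $A$ is cofinal if $\emptyset$ and $V$ are the only subsets of $V$ that are both hereditary and saturated. Powers: $A^0=I$, $A^1=A$, $A^{n+1}_{vw}=\sum_{u}A_{vu}A^n_{uw}$ (a priori in $[0,\infty]$). $NW$ is the set of vertices $v$ for which there is a finite path $\mu$ in $G$ with $s(\mu)=r(\mu)=v$. When $NW\neq\emptyset$, $\beta_0=\log\left(\limsup_n (A^n_{vv})^{1/n}\right)$ for $v\in NW$ (independent of $v\in NW$). A vector $\xi:V\to[0,\infty)$ is almost $\beta$-harmonic for $A$ if $\sum_{w}A_{vw}\xi_w=e^\beta\xi_v$ for all $v\in V\setminus V_\infty$ and $\sum_wA_{vw}\xi_w\le e^\beta\xi_v$ for all $v\in V_\infty$; it is $\beta$-harmonic if the equality holds for all $v\in V$. $E(A,\beta)$ is the set of almost $\beta$-harmonic vectors, and $E(A,\beta)_{v_0}=\{\xi\in E(A,\beta):\xi_{v_0}=1\}$, a convex subset of $\mathbb R^V$. $P(V)=\{(v_i)_{i=1}^\infty\in V^{\mathbb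 N}: A_{v_iv_{i+1}}>0,\ i=1,2,3,\dots\}$ is the set of infinite paths in $G$. *)

(* Defs.v *)
From HB Require Import structures.
From mathcomp Require Import all_boot all_order all_algebra.
From mathcomp Require Import all_classical all_reals all_analysis.

Set Implicit Arguments.
Unset Strict Implicit.
Unset Printing Implicit Defensive.

Import Order.TTheory GRing.Theory Num.Theory.
Import numFieldNormedType.Exports.

Local Open Scope classical_set_scope.
Local Open Scope ring_scope.
Local Open Scope ereal_scope.

Definition nonneg_mx (R : realType) (V : countType) (A : V -> V -> R) : Prop :=
  forall v w, (0 <= A v w)%R.

Definition no_zero_row (R : realType) (V : countType) (A : V -> V -> R) : Prop :=
  forall v, exists w, A v w != 0%R.

Definition edge (R : realType) (V : countType) (A : V -> V -> R) : rel V :=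
  [rel v w | A v w != 0%R].

(* There is at most one edge from v to w, so an edge is the pair of its
   initial and terminal vertices. *)
Definition edges (R : realType) (V : countType) (A : V -> V -> R) :
    set (V * V) :=
  [set e | edge A e.1 e.2].

Definition out_edges (R : realType) (V : countType) (A : V -> V -> R) (v : V) :
    set (V * V) :=
  edges A `&` fst @^-1` [set v].

Definition Vinfty (R : realType) (V : countType) (A : V -> V -> R) : set V :=
  [set v | out_edges A v = set0 \/ infinite_set (out_edges A v)].

Definition hereditary (R : realType) (V : countType) (A : V -> V -> R)
    (H : set V) : Prop :=
  forall e, edges A e -> H e.1 -> H e.2.

Definition saturated (R : realType) (V : countType) (A : V -> V -> R)
    (H : set V) : Prop :=
  forall v, ~ Vinfty A v -> snd @` out_edges A v `<=` H -> H v.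

Definition cofinal (R : realType) (V : countType) (A : V -> V -> R) : Prop :=
  forall H : set V, hereditary A H /\ saturated A H <-> H = set0 \/ H = setT.

Fixpoint mxpow (R : realType) (V : countType) (A : V -> V -> R) (n : nat)
    (v w : V) : \bar R :=
  if n is m.+1 then \esum_(u in [set: V]) ((A v u)%:E * mxpow A m u w)
  else (v == w)%:R%:E.

(* A finite path of length at least 1 from v back to v; p lists the terminal
   vertices of its successive edges. *)
Definition NW (R : realType) (V : countType) (A : V -> V -> R) : set V :=
  [set v | exists p : seq V, [/\ p != [::], path (edge A) v p & last v p = v]].

(* The term n = 0 of the sequence is 1 (as 0^-1 = 0), which does not affect the
   limit superior. *)
Definition beta0 (R : realType) (V : countType) (A : V -> V -> R) (v : V) :
    \bar R :=
  lne (limn_esup (fun n => mxpow A n v v `^ (n%:R^-1)%R)).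

Definition almost_harmonic (R : realType) (V : countType) (A : V -> V -> R)
    (beta : R) (xi : V -> R) : Prop :=
  [/\ forall v, (0 <= xi v)%R,
      forall v, ~ Vinfty A v ->
        \esum_(w in [set: V]) (A v w * xi w)%:E = (expR beta * xi v)%:E
    & forall v, Vinfty A v ->
        \esum_(w in [set: V]) (A v w * xi w)%:E <= (expR beta * xi v)%:E].

Definition harmonic_vector (R : realType) (V : countType) (A : V -> V -> R)
    (beta : R) (xi : V -> R) : Prop :=
  (forall v, (0 <= xi v)%R) /\
  forall v, \esum_(w in [set: V]) (A v w * xi w)%:E = (expR beta * xi v)%:E.

Definition normalized_almost_harmonic (R : realType) (V : countType)
    (A : V -> V -> R) (beta : R) (v0 : V) : set (V -> R^o) :=
  [set xi | almost_harmonic A beta xi /\ xi v0 = 1%R].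

Definition extreme_point (R : realType) (E : lmodType R) (C : set E) (x : E) :
    Prop :=
  C x /\ forall (y z : E) (t : R), C y -> C z -> (0 < t < 1)%R ->
    x = (t *: y + (1 - t) *: z)%R -> y = x /\ z = x.

Definition green (R : realType) (V : countType) (A : V -> V -> R) (beta : R)
    (v w : V) : \bar R :=
  \sum_(0 <= n <oo) (mxpow A n v w * (expR (- (n%:R * beta)))%:E).

(* Infinite paths are indexed from 0 instead of 1. *)
Definition infinite_paths (R : realType) (V : countType) (A : V -> V -> R) :
    set (nat -> V) :=
  [set t | forall i, (0 < A (t i) (t i.+1))%R].

(* Main.v *)
Require Import Defs.
From HB Require Import structures.
From mathcomp Require Import all_boot all_order all_algebra.
From mathcomp Require Import all_classical all_reals all_analysis.
From mathcomp Require Import ring lra.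

Set Implicit Arguments.
Unset Strict Implicit.
Unset Printing Implicit Defensive.

Import Order.TTheory GRing.Theory Num.Theory.
Import numFieldNormedType.Exports.

Local Open Scope classical_set_scope.
Local Open Scope ring_scope.

(* Put p = e^(-beta) A, so that psi is p-harmonic, let G be the Green kernel of p,
   and for a set C let r_C be the least p-superharmonic function dominating psi
   on C; it is psi times the probability that the psi-transform of p hits C.

   For finite C the function r_C is a potential with charge on C; hence a linear
   inequality b G(v0,w) <= a G(v,w) valid for all w in C passes to
   b r_C(v0) <= a r_C(v), and, by monotone limits, also for infinite C.  Let B be
   the set of all w satisfying the inequality, where a psi(v) < b, and let F_n be
   finite sets exhausting V.  As n grows, psi - r_(B \ F_n) increases to a harmonic
   function below psi, which by extremality is a multiple of psi; the inequality
   then forces r_(B \ F_n)(v0) -> 0.  With a = 1 and a = -1 this applies to the sets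
   where G(v,w)/G(v0,w) differs from psi(v) by at least 1/(k+1).  Removing from
   each of these countably many sets a large enough finite part, their union C
   satisfies r_C(v0) < psi(v0) = 1.

   It remains to find a path with distinct vertices that avoids C.  The function
   f = psi - r_C is subharmonic, vanishes on C and is positive at v0.  From a vertex
   w with f(w) > 0, replace f by the positive part of f - c G(.,w), with c such that
   this vanishes at w: it is still subharmonic, and since G(.,w) is not harmonic
   at w it is positive at some successor of w.  Iterating gives the path. *)

(** * Suprema of monotone sequences of extended reals *)

Lemma ereal_sup_shift (R : realType) (u : nat -> \bar R) (N : nat) :
  {homo u : m n / (m <= n)%N >-> (m <= n)%E} ->
  ereal_sup (range (fun n => u (n + N)%N)) = ereal_sup (range u).
Proof.
move=> ndu; apply/eqP; rewrite eq_le; apply/andP; split.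
  by apply: ge_ereal_sup => _ [n _ <-]; apply: ereal_sup_ubound; exists (n + N)%N.
apply: ge_ereal_sup => _ [n _ <-]; apply: (@le_trans _ _ (u (n + N)%N)).
  by apply: ndu; rewrite leq_addr.
by apply: ereal_sup_ubound; exists n.
Qed.

Lemma ereal_sup_addl (R : realType) (a : \bar R) (u : nat -> \bar R) :
  (0 <= a)%E -> (forall n, 0 <= u n)%E ->
  {homo u : m n / (m <= n)%N >-> (m <= n)%E} ->
  ereal_sup (range (fun n => a + u n)%E) = (a + ereal_sup (range u))%E.
Proof.
move=> a0 u0 ndu.
have cvu := ereal_nondecreasing_cvgn ndu.
have cvau : (fun n => a + u n)%E @ \oo --> (a + ereal_sup (range u))%E.
  apply: cvgeD => //; last exact: cvg_cst.
  rewrite ge0_adde_def// inE//.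
  by apply: le_ereal_sup_tmp; exists (u 0%N) => //; exists 0%N.
have ndau : {homo (fun n => a + u n)%E : m n / (m <= n)%N >-> (m <= n)%E}.
  by move=> m n mn; apply: leeD2l; exact: ndu.
exact: (cvg_unique _ (ereal_nondecreasing_cvgn ndau) cvau).
Qed.

Lemma nneseries_sup (R : realType) (u : nat -> \bar R) : (forall n, 0 <= u n)%E ->
  (\sum_(0 <= n <oo) u n)%E = ereal_sup (range (fun n => \sum_(0 <= i < n) u i)%E).
Proof.
move=> u0; apply/cvg_lim => //; apply: ereal_nondecreasing_cvgn.
by apply: lee_sum_nneg_natr => n _ _; exact: u0.
Qed.

(** * Potential theory of a non-negative kernel *)

Section Operator.
Context (R : realType) (V : countType) (p : V -> V -> R).
Hypothesis p0 : forall v w, 0 <= p v w.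
Local Open Scope ereal_scope.

Implicit Types (f g u : V -> \bar R) (v w : V).

Definition kop f v : \bar R := \esum_(w in [set: V]) ((p v w)%:E * f w).

Lemma kop_ge0 f v : (forall w, 0 <= f w) -> 0 <= kop f v.
Proof. by move=> f0; apply: esum_ge0 => w _; rewrite mule_ge0// lee_fin. Qed.

Lemma le_kop f g v : (forall w, f w <= g w) -> kop f v <= kop g v.
Proof.
by move=> fg; apply: le_esum => w _; rewrite lee_wpmul2l// lee_fin.
Qed.

Lemma eq_kop f g v : (forall w, f w = g w) -> kop f v = kop g v.
Proof. by move=> fg; apply: eq_esum => w _; rewrite fg. Qed.

Lemma kop0 v : kop (fun=> 0) v = 0.
Proof. by apply: esum1 => w _; rewrite mule0. Qed.

Lemma kopD f g v : (forall w, 0 <= f w) -> (forall w, 0 <= g w) ->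
  kop (fun w => f w + g w) v = kop f v + kop g v.
Proof.
move=> f0 g0; rewrite -esumD => [|w _|w _]; last 2 first.
- by rewrite mule_ge0// lee_fin.
- by rewrite mule_ge0// lee_fin.
by apply: eq_esum => w _; rewrite ge0_muleDr.
Qed.

Lemma kopZ_le (c : R) f v : (0 <= c)%R -> (forall w, 0 <= f w) ->
  kop (fun w => c%:E * f w) v <= c%:E * kop f v.
Proof.
move=> c0 f0; apply: ge_ereal_sup => _ [X [finX _] <-].
rewrite fsbig_finite//= (eq_bigr (fun w => c%:E * ((p v w)%:E * f w))); last first.
  by move=> w _; rewrite muleCA.
rewrite -ge0_sume_distrr; last by move=> w _; rewrite mule_ge0// lee_fin.
rewrite lee_wpmul2l ?lee_fin//; apply: esum_ge; exists X => //.
by rewrite fsbig_finite.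
Qed.

Lemma kopZ (c : R) f v : (0 <= c)%R -> (forall w, 0 <= f w) ->
  kop (fun w => c%:E * f w) v = c%:E * kop f v.
Proof.
move=> c0 f0; apply/eqP; rewrite eq_le kopZ_le//=.
have [->|cn0] := eqVneq c 0%R.
  by rewrite mul0e; apply: kop_ge0 => w; rewrite mul0e.
have cp : (0 < c)%R by rewrite lt_def cn0.
have Vc0 : (0 <= c^-1)%R by rewrite invr_ge0.
(* The reverse inequality is [kopZ_le] with factor [c^-1], applied to [c f]. *)
rewrite -lee_pdivlMl//; apply: le_trans (kopZ_le v Vc0 _); last first.
  by move=> w; rewrite mule_ge0// lee_fin.
by apply: le_kop => w; rewrite muleA -EFinM mulVf// mul1e.
Qed.

(** Monotone convergence: a finite partial sum for the supremum is the limit of the same partial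
    sums for [F n], each at most [kop (F n) v]. *)
Lemma kop_sup (F : nat -> V -> \bar R) v : (forall n w, 0 <= F n w) ->
  (forall w, {homo F ^~ w : m n / (m <= n)%N >-> (m <= n)%E}) ->
  kop (fun w => ereal_sup (range (F ^~ w))) v =
    ereal_sup (range (fun n => kop (F n) v)).
Proof.
move=> F0 ndF; apply/eqP; rewrite eq_le; apply/andP; split; last first.
  apply: ge_ereal_sup => _ [n _ <-]; apply: le_kop => w.
  by apply: ereal_sup_ubound; exists n.
apply: ge_ereal_sup => _ [X [finX _] <-]; rewrite fsbig_finite//=.
set T : nat -> \bar R :=
  fun n => \sum_(w <- finmap.enum_fset (fset_set X)) (p v w)%:E * F n w.
have cvT : T @ \oo --> \sum_(w <- finmap.enum_fset (fset_set X))
    (p v w)%:E * ereal_sup (range (F ^~ w)).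
  apply: cvg_nnesum => w _; first by apply: nearW => n; rewrite mule_ge0// lee_fin.
  by apply: cvgeZl => //; exact: ereal_nondecreasing_cvgn.
rewrite -(cvg_lim _ cvT)//; apply: lime_le; first by apply/cvg_ex; eexists;
  exact: cvT.
apply: nearW => n; apply: le_ereal_sup_tmp; exists (kop (F n) v); first by exists n.
by apply: esum_ge; exists X => //; rewrite fsbig_finite.
Qed.

Lemma kop_sum (F : nat -> V -> \bar R) n v : (forall i w, 0 <= F i w) ->
  kop (fun w => \sum_(0 <= i < n) F i w) v = \sum_(0 <= i < n) kop (F i) v.
Proof.
move=> F0; elim: n => [|n IH].
  rewrite big_geq// -[RHS](kop0 v); apply: eq_kop => w; by rewrite big_geq.
rewrite big_nat_recr//= -IH -kopD//; last by move=> w; apply: sume_ge0.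
by apply: eq_kop => w; rewrite big_nat_recr.
Qed.

Lemma iter_kop_ge0 n f v : (forall w, 0 <= f w) -> 0 <= iter n kop f v.
Proof. by move=> f0; elim: n v => [|n IH] v //=; exact: kop_ge0. Qed.

Definition potential (nu : V -> \bar R) v : \bar R :=
  \sum_(0 <= n <oo) iter n kop nu v.

Lemma potential_ge0 nu v : (forall w, 0 <= nu w) -> 0 <= potential nu v.
Proof. by move=> nu0; apply: nneseries_ge0 => n _ _; exact: iter_kop_ge0. Qed.

(** Applying [kop] to a partial sum and adding [nu] gives the next partial sum; monotone convergence
    passes to the limit. *)
Lemma potentialE nu v : (forall w, 0 <= nu w) ->
  potential nu v = nu v + kop (potential nu) v.
Proof.
move=> nu0.
have it0 n w : 0 <= iter n kop nu w by exact: iter_kop_ge0.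
pose S n w := \sum_(0 <= i < n) iter i kop nu w.
have S0 n w : 0 <= S n w by exact: sume_ge0.
have ndS w : {homo S ^~ w : m n / (m <= n)%N >-> m <= n}.
  by apply: lee_sum_nneg_natr => n _ _; exact: it0.
have potS w : potential nu w = ereal_sup (range (S ^~ w)) by exact: nneseries_sup.
rewrite (eq_kop v potS) kop_sup// potS -(ereal_sup_shift 1 (ndS v)).
rewrite -ereal_sup_addl//; last 2 first.
- by move=> n; exact: kop_ge0.
- by move=> m n mn; apply: le_kop => w; exact: ndS.
suff -> : (fun n => S (n + 1)%N v) = (fun n => nu v + kop (S n) v) by [].
by apply/funext => n; rewrite addn1 /S big_nat_recl// kop_sum.
Qed.

(** A supersolution dominates all partial sums by induction: [S (n+1) = nu + kop (S n) <= nu + kop u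
    <= u]. *)
Lemma potential_min nu u v : (forall w, 0 <= nu w) -> (forall w, 0 <= u w) ->
  (forall w, nu w + kop u w <= u w) -> potential nu v <= u v.
Proof.
move=> nu0 u0 hu; rewrite /potential nneseries_sup; last first.
  by move=> n; exact: iter_kop_ge0.
apply: ge_ereal_sup => _ [n _ <-]; elim: n v => [|n IH] v; first by rewrite big_geq.
rewrite big_nat_recl//= -kop_sum; last by move=> i w; exact: iter_kop_ge0.
by apply: le_trans (hu v); apply: leeD2l; exact: le_kop.
Qed.

Lemma potentialD nu1 nu2 v : (forall w, 0 <= nu1 w) -> (forall w, 0 <= nu2 w) ->
  potential (fun w => nu1 w + nu2 w) v = potential nu1 v + potential nu2 v.
Proof.
move=> nu10 nu20; rewrite /potential -nneseriesD => [|n _ _|n _ _]; last 2 first.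
- exact: iter_kop_ge0.
- exact: iter_kop_ge0.
apply: eq_eseriesr => n _; elim: n v => [|n IH] v//=.
rewrite -kopD => [|w|w]; [|exact: iter_kop_ge0|exact: iter_kop_ge0].
exact: (eq_kop _ IH).
Qed.

Lemma potentialZ (c : R) nu v : (0 <= c)%R -> (forall w, 0 <= nu w) ->
  potential (fun w => c%:E * nu w) v = c%:E * potential nu v.
Proof.
move=> c0 nu0; rewrite /potential -nneseriesZl => [|n _]; last exact: iter_kop_ge0.
apply: eq_eseriesr => n _; elim: n v => [|n IH] v//=.
rewrite -kopZ => [||w]; [exact: (eq_kop _ IH)|by []|exact: iter_kop_ge0].
Qed.

Lemma potential0 v : potential (fun=> 0) v = 0.
Proof.
apply/eqP; rewrite eq_le potential_ge0// andbT;
  apply: (@potential_min _ (fun=> 0)) => //.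
by move=> w; rewrite kop0 adde0.
Qed.

Lemma potential_sum (I : Type) (s : seq I) (c : I -> R) (F : I -> V -> \bar R) v :
  (forall i, (0 <= c i)%R) -> (forall i w, 0 <= F i w) ->
  potential (fun w => \sum_(i <- s) (c i)%:E * F i w) v =
  \sum_(i <- s) (c i)%:E * potential (F i) v.
Proof.
move=> c0 F0; have cF0 i w : 0 <= (c i)%:E * F i w by rewrite mule_ge0 ?lee_fin.
elim: s => [|i s IH].
  rewrite big_nil -[RHS](potential0 v); congr (potential _ v).
  by apply/funext => w; rewrite big_nil.
rewrite big_cons -IH -potentialZ// -potentialD//; last by move=> w; exact: sume_ge0.
by congr (potential _ v); apply/funext => w; rewrite big_cons.
Qed.

Definition dirac_at w v : \bar R := (v == w)%:R%:E.

Lemma dirac_at_ge0 w v : 0 <= dirac_at w v.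
Proof. by rewrite lee_fin ler0n. Qed.

Definition greenk v w : \bar R := potential (dirac_at w) v.

Lemma greenk_ge0 v w : 0 <= greenk v w.
Proof. by apply: potential_ge0 => u; exact: dirac_at_ge0. Qed.

Lemma greenkE v w : greenk v w = dirac_at w v + kop (greenk ^~ w) v.
Proof. by apply: potentialE => u; exact: dirac_at_ge0. Qed.

Lemma greenk_ge1 v : 1 <= greenk v v.
Proof. by rewrite greenkE /dirac_at eqxx leeDl// kop_ge0// => w;
  exact: greenk_ge0. Qed.

Lemma potential_fin_supp (nu : V -> R) (s : seq V) v : uniq s ->
  (forall w, (0 <= nu w)%R) -> (forall w, w \notin s -> nu w = 0%R) ->
  potential (EFin \o nu) v = \sum_(w <- s) (nu w)%:E * greenk v w.
Proof.
move=> us nu0 nus; rewrite -potential_sum//; last by move=> w u; exact: dirac_at_ge0.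
congr (potential _ v); apply/funext => w /=.
have [ws|ws] := boolP (w \in s).
  rewrite (bigD1_seq w)//= /dirac_at eqxx mule1 big1 ?adde0// => u uw.
  by rewrite eq_sym (negbTE uw) mule0.
rewrite nus// big1_seq// => u /andP[_ us']; rewrite /dirac_at.
by case: eqP => [E|_]; [rewrite E us' in ws|rewrite mule0].
Qed.
(** * Superharmonic and reduced functions *)

Definition superharmonic u :=
  (forall w, 0 <= u w) /\ (forall w, kop u w <= u w).

Lemma superharmonicD u1 u2 : superharmonic u1 -> superharmonic u2 ->
  superharmonic (fun w => u1 w + u2 w).
Proof.
move=> [u10 Pu1] [u20 Pu2]; split=> w; first exact: adde_ge0.
by rewrite kopD//; exact: leeD.
Qed.

Lemma superharmonic_sup (F : nat -> V -> \bar R) : (forall n, superharmonic (F n)) ->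
  (forall w, {homo F ^~ w : m n / (m <= n)%N >-> m <= n}) ->
  superharmonic (fun w => ereal_sup (range (F ^~ w))).
Proof.
move=> sF ndF; split=> w.
  apply: le_ereal_sup_tmp; exists (F 0%N w); first by exists 0%N.
  exact: (sF 0%N).1.
rewrite kop_sup//; last by move=> n; exact: (sF n).1.
apply: ge_ereal_sup => _ [n _ <-]; apply: (le_trans ((sF n).2 w)).
by apply: ereal_sup_ubound; exists n.
Qed.

Lemma superharmonic_potential nu : (forall w, 0 <= nu w) ->
  superharmonic (potential nu).
Proof.
move=> nu0; split=> w; first exact: potential_ge0.
by rewrite [leRHS]potentialE// leeDr.
Qed.

Section Reduced.
Variable psi : V -> R.
Hypothesis psi0 : forall v, (0 <= psi v)%R.
Hypothesis psi_harm : forall v, kop (EFin \o psi) v = (psi v)%:E.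
Implicit Type C D : set V.

Definition reduced C v : \bar R :=
  ereal_inf [set u v | u in
    [set u | superharmonic u /\ forall w, C w -> (psi w)%:E <= u w]].

Lemma reduced_ge0 C v : 0 <= reduced C v.
Proof. by apply: le_ereal_inf_tmp => _ [u [[u0 _] _] <-]. Qed.

Lemma reduced_le C u v : superharmonic u ->
  (forall w, C w -> (psi w)%:E <= u w) -> reduced C v <= u v.
Proof. by move=> su Cu; apply: ereal_inf_lbound; exists u. Qed.

Lemma reduced_le_psi C v : reduced C v <= (psi v)%:E.
Proof.
apply: (@reduced_le C (EFin \o psi)) => //; split=> w; first by rewrite lee_fin.
by rewrite psi_harm.
Qed.

Lemma reduced_fin C v : reduced C v \is a fin_num.
Proof.
rewrite ge0_fin_numE ?reduced_ge0//.
by apply: le_lt_trans (reduced_le_psi C v) _; rewrite ltry.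
Qed.

(** Every competitor [u] satisfies [kop (reduced C) <= kop u <= u]; then take the infimum over
    [u]. *)
Lemma superharmonic_reduced C : superharmonic (reduced C).
Proof.
split=> [w|v]; first exact: reduced_ge0.
apply: le_ereal_inf_tmp => _ [u [su Cu] <-]; apply: le_trans (su.2 v).
by apply: le_kop => w; exact: reduced_le.
Qed.

Lemma reduced_in C v : C v -> reduced C v = (psi v)%:E.
Proof.
move=> Cv; apply/eqP; rewrite eq_le reduced_le_psi/=.
by apply: le_ereal_inf_tmp => _ [u [_ Cu] <-]; exact: Cu.
Qed.

(* Otherwise lowering [reduced C] to [kop (reduced C)] off [C] would give a
   smaller competitor. *)
Lemma reduced_notin C v : ~ C v -> reduced C v = kop (reduced C) v.
Proof.
move=> Cv; have [r0 Pr] := superharmonic_reduced C.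
apply/eqP; rewrite eq_le Pr andbT.
pose u w := if w \in C then reduced C w else kop (reduced C) w.
have ur w : u w <= reduced C w by rewrite /u; case: ifP.
have u0 w : 0 <= u w by rewrite /u; case: ifP => // _; exact: kop_ge0.
have -> : kop (reduced C) v = u v by rewrite /u memNset.
apply: reduced_le; last by move=> w Cw; rewrite /u mem_set// reduced_in.
split=> // w; rewrite [leRHS]/u; case: ifP => _; last exact: le_kop.
by apply: le_trans (Pr w); exact: le_kop.
Qed.

Lemma le_reduced C D v : C `<=` D -> reduced C v <= reduced D v.
Proof.
move=> CD; apply: reduced_le; first exact: superharmonic_reduced.
by move=> w /CD Dw; rewrite reduced_in.
Qed.

Lemma reduced0 v : reduced set0 v = 0.
Proof.
apply/eqP; rewrite eq_le reduced_ge0 andbT; apply: (@reduced_le _ (fun=> 0)) => //.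
by split=> // w; rewrite kop0.
Qed.

Lemma reduced_setU C D v : reduced (C `|` D) v <= reduced C v + reduced D v.
Proof.
apply: (@reduced_le _ (fun v => reduced C v + reduced D v)).
  by apply: superharmonicD; exact: superharmonic_reduced.
move=> w [Cw|Dw]; first by rewrite (reduced_in Cw) leeDl ?reduced_ge0.
by rewrite (reduced_in Dw) leeDr ?reduced_ge0.
Qed.

(** By monotone convergence the supremum is superharmonic, and it dominates [psi] on the union, so
    it is a competitor. *)
Lemma reduced_bigcup_sup (C : nat -> set V) v :
  {homo C : m n / (m <= n)%N >-> m `<=` n} ->
  reduced (\bigcup_n C n) v <= ereal_sup (range (fun n => reduced (C n) v)).
Proof.
move=> ndC;
  apply: (@reduced_le _ (fun v => ereal_sup (range (fun n => reduced (C n) v)))).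
  apply: superharmonic_sup => [n|w m n mn]; first exact: superharmonic_reduced.
  by apply: le_reduced; exact: ndC.
move=> w [n _ Cw]; apply: le_ereal_sup_tmp; exists (reduced (C n) w); first
  by exists n.
by rewrite reduced_in.
Qed.

Lemma reduced_bigcup_geometric (C : nat -> set V) v (e : R) : (0 <= e)%R ->
  (forall n, reduced (C n) v <= (e / (2 ^ n.+1)%:R)%:E) ->
  reduced (\bigcup_n C n) v <= e%:E.
Proof.
(* Partial unions form an increasing family, to which [reduced_bigcup_sup] applies. *)
move=> e0 Ce; pose D n := \big[setU/set0]_(i < n) C i.
have -> : \bigcup_n C n = \bigcup_n D n.
  rewrite eqEsubset; split=> w [n _]; first by move=> Cw; exists n.+1 => //;
    exact: bigsetU_sup Cw.
  exact: bigsetU_bigcup.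
apply: le_trans (reduced_bigcup_sup _ _) _; first exact: subset_bigsetU.
apply: ge_ereal_sup => _ [n _ <-].
apply: (@le_trans _ _ (\sum_(0 <= i < n) (e / (2 ^ i.+1)%:R)%:E)); last first.
  apply: le_trans (epsilon_trick0 xpredT e0); rewrite nneseries_sup.
    by apply: ereal_sup_ubound; exists n.
  by move=> i; rewrite lee_fin divr_ge0.
rewrite /D; elim: n => [|n IH]; first by rewrite big_ord0 big_geq// reduced0.
rewrite big_ord_recr big_nat_recr//=; apply: le_trans (reduced_setU _ _ _) _.
exact: leeD.
Qed.

(** * Linear inequalities between Green functions and reduced functions *)

Hypothesis greenk_fin : forall v w, greenk v w < +oo.

Lemma greenk_fin_num v w : greenk v w \is a fin_num.
Proof. by rewrite ge0_fin_numE ?greenk_ge0. Qed.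

(* Uniqueness in the Riesz decomposition: writing [r] for the reduced function,
   [g] for the potential of its charge [mu] and [K] for a potential above [r],
   the function [K - r + g] has the same charge as [K], hence dominates [K]. *)
Lemma reduced_finite (s : seq V) : uniq s ->
  exists2 mu : V -> R, forall w, (0 <= mu w)%R &
    forall v, reduced [set` s] v = \sum_(w <- s) (mu w)%:E * greenk v w.
Proof.
move=> us; set r := reduced [set` s].
have rfin w : r w \is a fin_num by exact: reduced_fin.
have [r0 Pr] : superharmonic r by exact: superharmonic_reduced.
have Prfin w : kop r w \is a fin_num.
  rewrite ge0_fin_numE ?kop_ge0//; apply: le_lt_trans (Pr w) _.
  by rewrite -ge0_fin_numE.
pose mu w := fine (r w - kop r w).
have rE w : r w = (mu w)%:E + kop r w.
  by rewrite /mu fineK ?fin_numB ?rfin ?Prfin// subeK.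
have mu0 w : (0 <= mu w)%R by rewrite fine_ge0// sube_ge0 ?Pr// Prfin.
have mus w : w \notin s -> mu w = 0%R.
  by move=> /negP ws; rewrite /mu {1}/r reduced_notin// -/r subee.
(* The charge [psi] on [s] has a potential [K] that is at least [psi] on [s], hence above [r], and
   finite because [s] is finite. *)
pose nu w := if w \in s then psi w else 0%R.
have nu0 w : (0 <= nu w)%R by rewrite /nu; case: ifP.
have nus w : w \notin s -> nu w = 0%R by rewrite /nu => /negbTE ->.
have Enu0 w : 0 <= (EFin \o nu) w by rewrite lee_fin.
have Emu0 w : 0 <= (EFin \o mu) w by rewrite lee_fin.
pose K := potential (EFin \o nu); pose g := potential (EFin \o mu).
have K0 w : 0 <= K w by exact: potential_ge0.
have g0 w : 0 <= g w by exact: potential_ge0.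
have rK w : r w <= K w.
  apply: reduced_le; first exact: superharmonic_potential.
  move=> u /= us'; rewrite /K potentialE//= {1}/nu us' leeDl//.
  exact: kop_ge0.
have g_le_r w : g w <= r w.
  by apply: potential_min => // u; rewrite /= -rE.
have Kfin w : K w \is a fin_num.
  rewrite /K (potential_fin_supp _ us)//; apply/sum_fin_numP => u _ _.
  by rewrite fin_numM// greenk_fin_num.
have gfin w : g w \is a fin_num.
  by rewrite ge0_fin_numE//; apply: le_lt_trans (g_le_r w) _; rewrite -ge0_fin_numE.
pose u w := K w - r w + g w.
have u0 w : 0 <= u w by rewrite adde_ge0// sube_ge0 ?rK// rfin.
have uE w : u w + r w = K w + g w by rewrite /u addeAC subeK.
have PuE w : kop u w + kop r w = kop K w + kop g w.
  by rewrite -!kopD//; exact: eq_kop.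
have Ku w : K w <= u w.
  apply: potential_min => // x.
  rewrite -(leeD2rE _ _ (rfin x)) uE [X in X <= _]/= {1}rE.
  rewrite addeACA PuE.
  by rewrite [K x](potentialE x Enu0) [g x](potentialE x Emu0) addeACA.
exists mu => // v; rewrite -potential_fin_supp//; apply/eqP;
  rewrite eq_le g_le_r andbT.
have := Ku v; rewrite /u addeAC -{1}[K v]adde0 -addeA leeD2lE//.
by rewrite sube_ge0// rfin.
Qed.

(** The weights [mu w >= 0] do not depend on the starting vertex, so the inequalities can be summed;
    [a] and [b] may have any sign. *)
Lemma reduced_finite_le (s : seq V) (a b : R) v v0 : uniq s ->
  (forall w, w \in s -> (b * fine (greenk v0 w) <= a * fine (greenk v w))%R) ->
  (b * fine (reduced [set` s] v0) <= a * fine (reduced [set` s] v))%R.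
Proof.
move=> us abs; have [mu mu0 rE] := reduced_finite us.
have frE x : fine (reduced [set` s] x) = (\sum_(w <- s) mu w * fine (greenk x w))%R.
  rewrite rE -sum_fine => [|w _]; last by rewrite fin_numM// greenk_fin_num.
  by apply: eq_bigr => w _; rewrite fineM// greenk_fin_num.
rewrite !frE !mulr_sumr !big_seq; apply: ler_sum => w ws.
by rewrite mulrCA [leRHS]mulrCA ler_wpM2l// abs.
Qed.

Definition initial_segment n : set V := [set w | (pickle w < n)%N].

Lemma finite_initial_segment n : finite_set (initial_segment n).
Proof.
apply: (@finite_preimage _ _ `I_n (@pickle V)); last exact: finite_II.
by move=> v w _ _; exact: (pcan_inj pickleK).
Qed.

Lemma cvg_fine_sup (f : nat -> \bar R) : {homo f : m n / (m <= n)%N >-> m <= n} ->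
  ereal_sup (range f) \is a fin_num ->
  (fun n => fine (f n)) @ \oo --> fine (ereal_sup (range f)).
Proof.
move=> ndf ffin; apply: fine_cvg; rewrite fineK//; exact: ereal_nondecreasing_cvgn.
Qed.

(** The finite case applies to [C] cut by initial segments. The reduced functions converge to a
    finite limit, so the inequality passes to it even for negative [a] or [b]. *)
Lemma reduced_half_space (C : set V) (a b : R) v v0 :
  (forall w, C w -> (b * fine (greenk v0 w) <= a * fine (greenk v w))%R) ->
  (b * fine (reduced C v0) <= a * fine (reduced C v))%R.
Proof.
move=> abC; pose D n := C `&` initial_segment n.
have ndD : {homo D : m n / (m <= n)%N >-> m `<=` n}.
  by move=> m n mn w [Cw wm]; split=> //; exact: leq_trans wm mn.
have DC : \bigcup_n D n = C.
  rewrite eqEsubset; split=> [w [n _ []]//|w Cw].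
  by exists (pickle w).+1 => //; split=> //; rewrite /initial_segment/=.
have ndr x : {homo (fun n => reduced (D n) x) : m n / (m <= n)%N >-> m <= n}.
  by move=> m n mn; apply: le_reduced; exact: ndD.
have supr x : ereal_sup (range (fun n => reduced (D n) x)) = reduced C x.
  apply/eqP; rewrite eq_le -{2}DC reduced_bigcup_sup// andbT.
  by apply: ge_ereal_sup => _ [n _ <-]; apply: le_reduced => w [].
have cvr x : (fun n => fine (reduced (D n) x)) @ \oo --> fine (reduced C x).
  by rewrite -supr; apply: cvg_fine_sup => //; rewrite supr reduced_fin.
apply: (@ler_cvg_to _ \oo _ _ (fun n => b * fine (reduced (D n) v0))%R
  (fun n => a * fine (reduced (D n) v))%R); [exact: cvgMl_tmp|exact: cvgMl_tmp|].
apply: nearW => n.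
have /finite_seqP[s Ds] : finite_set (D n).
  by apply: sub_finite_set (finite_initial_segment n); exact: subIsetr.
have -> : D n = [set` undup s] by rewrite Ds; apply/seteqP; split=> w /=;
  rewrite mem_undup.
apply: reduced_finite_le; first exact: undup_uniq.
move=> w; rewrite mem_undup => ws; apply: abC.
by have [] : D n w by rewrite Ds.
Qed.

(** * Paths in the positivity set of a subharmonic function *)

Definition subharmonic (f : V -> R) :=
  (forall v, (0 <= f v)%R) /\ forall v, (f v)%:E <= kop (EFin \o f) v.

(* [f'] is the positive part of [f - c G(., w)], with [c] chosen so that it
   vanishes at [w]; as [G(., w)] fails to be harmonic exactly at [w],
   [kop f' w >= c > 0]. *)
Lemma subharmonic_step (f : V -> R) w : subharmonic f -> (0 < f w)%R ->
  exists w' (f' : V -> R), [/\ subharmonic f', forall v, (f' v <= f v)%R, f' w = 0%R,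
    (0 < p w w')%R & (0 < f' w')%R].
Proof.
move=> [f0 fP] fw; pose G v := fine (greenk v w).
have GE v : (G v)%:E = greenk v w by rewrite fineK// greenk_fin_num.
have G0 v : (0 <= G v)%R by rewrite -lee_fin GE greenk_ge0.
have Gw : (1 <= G w)%R by rewrite -lee_fin GE greenk_ge1.
have Gw0 : (0 < G w)%R by exact: lt_le_trans Gw.
pose c := (f w / G w)%R.
have c0 : (0 < c)%R by rewrite divr_gt0.
pose f' v := Num.max 0%R (f v - c * G v)%R.
have f'0 v : (0 <= f' v)%R by rewrite le_max lexx.
have Ef'0 v : 0 <= (EFin \o f') v by rewrite lee_fin.
have EG0 v : 0 <= (EFin \o G) v by rewrite lee_fin.
have Ef0 v : 0 <= (EFin \o f) v by rewrite lee_fin.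
have ff' v : (f v <= f' v + c * G v)%R by rewrite -lerBlDr le_max lexx orbT.
(* Apply [kop] to [f <= f' + c G] and replace [kop G] by [G] minus the unit mass at [w]. *)
have key v : (f v + c * (v == w)%:R - c * G v)%:E <= kop (EFin \o f') v.
  have PG : c%:E * greenk v w = c%:E * (v == w)%:R%:E + c%:E * kop (EFin \o G) v.
    rewrite -ge0_muleDr ?lee_fin ?ler0n//; last exact: kop_ge0.
    by rewrite greenkE (eq_kop v GE).
  have : (f v)%:E <= kop (EFin \o f') v + c%:E * kop (EFin \o G) v.
    apply: le_trans (fP v) _; rewrite -(kopZ _ (ltW c0))// -kopD//; last first.
      by move=> x; rewrite mule_ge0// lee_fin (ltW c0).
    by apply: le_kop => x; rewrite /= -EFinM -EFinD lee_fin.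
  move=> le1; have cGE : (c * G v)%:E = c%:E * greenk v w by rewrite EFinM GE.
  rewrite EFinB leeBlDr// cGE PG EFinD EFinM addeCA addeC.
  by rewrite leeD2l.
have f'w : f' w = 0%R by rewrite /f' /c divfK ?gt_eqF// subrr maxxx.
have Pf'w : 0 < kop (EFin \o f') w.
  apply: lt_le_trans (key w); rewrite lte_fin eqxx mulr1 /c divfK ?gt_eqF//.
  by rewrite addrAC subrr add0r.
have [w' pf'] : exists w', (0 < p w w' * f' w')%R.
  apply: contrapT => /forallNP npos; move: Pf'w; apply/negP; rewrite -leNgt.
  rewrite /kop esum1// => x _; apply/eqP.
  rewrite /= -EFinM eqe eq_le mulr_ge0// andbT leNgt; exact/negP.
exists w', f'; split=> //.
- split=> // v; have [le0|gt0] := leP (f v - c * G v)%R 0%R.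
    by rewrite {1}/f' max_l// kop_ge0.
  rewrite {1}/f' (max_r (ltW gt0)); apply: le_trans (key v).
  by rewrite lee_fin lerD2r lerDl mulr_ge0// (ltW c0).
- by move=> v; rewrite ge_max f0 lerBlDr lerDl mulr_ge0// (ltW c0).
- rewrite lt_def p0 andbT; apply: contraTneq pf' => ->.
  by rewrite mul0r ltxx.
- rewrite lt_def f'0 andbT; apply: contraTneq pf' => ->.
  by rewrite mulr0 ltxx.
Qed.

Lemma subharmonic_path (f : V -> R) v0 : subharmonic f -> (0 < f v0)%R ->
  exists t : nat -> V, [/\ t 0%N = v0, forall i, (0 < p (t i) (t i.+1))%R,
    injective t & forall i, (0 < f (t i))%R].
Proof.
move=> sf fv0.
(* The state of the recursion couples the current vertex with a subharmonic function positive
   there. *)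
pose X := {x : V * (V -> R) | subharmonic x.2 /\ (0 < x.2 x.1)%R}.
pose next (x y : X) := [/\ (0 < p (sval x).1 (sval y).1)%R,
  forall v, ((sval y).2 v <= (sval x).2 v)%R & (sval y).2 (sval x).1 = 0%R].
have [x|s [s0 sS]] := @dependent_choice X next _ (exist _ (v0, f) (conj sf fv0)).
  case: x => -[w g] [/= sg gw]; apply: cid.
  have [w' [g' [sg' g'g g'w pww' g'w']]] := subharmonic_step sg gw.
  by exists (exist _ (w', g') (conj sg' g'w')).
pose t n := (sval (s n)).1; pose F n := (sval (s n)).2.
have ndF : forall m n v, (m <= n)%N -> (F n v <= F m v)%R.
  move=> m n v; elim: n => [|n IH]; first by rewrite leqn0 => /eqP ->.
  rewrite leq_eqVlt => /predU1P[->//|/IH]; apply: le_trans.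
  by have [_ + _] := sS n; exact.
have Ft n : (0 < F n (t n))%R by exact: (svalP (s n)).2.
have F0 n v : (0 <= F n v)%R by exact: (svalP (s n)).1.1.
(* For [m < n], [F n <= F m.+1] and [F m.+1] vanishes at [t m], whereas [F n] is positive at
   [t n]. *)
have neq m n : (m < n)%N -> t m <> t n.
  move=> mn tmn; have [_ _ Fm] := sS m; have := Ft n; apply/negP; rewrite -leNgt.
  by rewrite -tmn -Fm; exact: ndF.
exists t; split=> [|i|i j tij|i]; first by rewrite /t s0.
- by have [] := sS i.
- by case: (ltngtP i j) => // /neq; rewrite tij.
- apply: lt_le_trans (Ft i) _; have -> : f = F 0%N by rewrite /F s0.
  exact: ndF.
Qed.

(** The harmonic [psi] minus the superharmonic [reduced C] is subharmonic and vanishes on [C], so a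
    path in its positivity set misses [C]. *)
Lemma reduced_avoid_path (C : set V) v0 : reduced C v0 < (psi v0)%:E ->
  exists t : nat -> V, [/\ t 0%N = v0, forall i, (0 < p (t i) (t i.+1))%R,
    injective t & forall i, ~ C (t i)].
Proof.
move=> Cv0; pose f v := fine ((psi v)%:E - reduced C v).
have fE v : (f v)%:E = (psi v)%:E - reduced C v.
  by rewrite fineK// fin_numB reduced_fin.
have f0 v : (0 <= f v)%R.
  by rewrite -lee_fin fE sube_ge0 ?reduced_fin//; exact: reduced_le_psi.
have sf : subharmonic f.
  split=> // v; rewrite fE leeBlDr ?reduced_fin// -psi_harm.
  have [r0 Pr] := superharmonic_reduced C.
  apply: le_trans (leeD2l _ (Pr v)); rewrite -kopD//.
  by apply: le_kop => w; rewrite /= fE subeK// reduced_fin.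
have fv0 : (0 < f v0)%R by rewrite -lte_fin fE sube_gt0.
have [t [t0 pt injt ft]] := subharmonic_path sf fv0.
exists t; split=> // i Cti; have := ft i.
by rewrite -lte_fin fE (reduced_in Cti) subee// ltxx.
Qed.

(** * Extremality and the tails of reduced functions *)

Variable v0 : V.
Hypothesis psi_v0 : psi v0 = 1%R.
Hypothesis psi_min : forall h : V -> R, (forall v, (0 <= h v <= psi v)%R) ->
  (forall v, kop (EFin \o h) v = (h v)%:E) -> forall v, h v = (h v0 * psi v)%R.

Lemma reduced_tail (a b : R) v (e : R) : (a * psi v < b)%R -> (0 < e)%R ->
  exists n, reduced ([set w | (b * fine (greenk v0 w) <= a * fine (greenk v w))%R]
    `\` initial_segment n) v0 <= e%:E.
Proof.
set B := [set w | _] => ab e0; pose D n := B `\` initial_segment n.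
have ndD m n : (m <= n)%N -> D n `<=` D m.
  by move=> mn w [Bw wn]; split=> // wm; apply: wn; exact: leq_trans wm mn.
pose s n w := (psi w)%:E - reduced (D n) w.
have s0 n w : 0 <= s n w by rewrite sube_ge0 ?reduced_fin//; exact: reduced_le_psi.
have spsi n w : s n w <= (psi w)%:E
  by rewrite leeBlDr ?reduced_fin// leeDl// reduced_ge0.
have nds w : {homo s ^~ w : m n / (m <= n)%N >-> m <= n}.
  by move=> m n mn; apply: leeB => //; apply: le_reduced; exact: ndD.
pose S w := ereal_sup (range (s ^~ w)).
have S0 w : 0 <= S w by apply: le_ereal_sup_tmp; exists (s 0%N w) => //; exists 0%N.
have Spsi w : S w <= (psi w)%:E by apply: ge_ereal_sup => _ [n _ <-].
have Sfin w : S w \is a fin_num.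
  by rewrite ge0_fin_numE//; apply: le_lt_trans (Spsi w) _; rewrite ltry.
have sr n w : s n w + reduced (D n) w = (psi w)%:E by rewrite subeK// reduced_fin.
(* Off [D n] both [psi] and [reduced (D n)] are harmonic, hence so is their difference. *)
have sharm n w : (pickle w < n)%N -> kop (s n) w = s n w.
  move=> wn; have Dw : ~ D n w by move=> -[_]; exact.
  have : kop (s n) w + kop (reduced (D n)) w = s n w + reduced (D n) w.
    rewrite -kopD//; last by move=> x; exact: reduced_ge0.
    by rewrite (eq_kop w (sr n)) sr; exact: psi_harm.
  rewrite -reduced_notin// => /eqP; rewrite eq_le => /andP[].
  by rewrite !leeD2rE ?reduced_fin// => *; apply/eqP; rewrite eq_le; apply/andP.
pose h w := fine (S w).
have hS w : (h w)%:E = S w by rewrite fineK.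
have hP : forall w, h w = (h v0 * psi w)%R.
  apply: psi_min => w; first by rewrite -!lee_fin hS S0 Spsi.
  rewrite hS (eq_kop w hS) kop_sup//.
  have ndks : {homo (fun n => kop (s n) w) : m n / (m <= n)%N >-> m <= n}.
    by move=> m n mn; apply: le_kop => x; exact: nds.
  (* Harmonicity of [s n] at [w] holds from [n = (pickle w).+1] on; dropping the earlier terms
     leaves both suprema unchanged. *)
  rewrite /S -(ereal_sup_shift (pickle w).+1 ndks).
  rewrite -(ereal_sup_shift (pickle w).+1 (nds w)).
  suff -> : (fun n => kop (s (n + (pickle w).+1)%N) w) =
      (fun n => s (n + (pickle w).+1)%N w) by [].
  by apply/funext => n; apply: sharm; rewrite addnS ltnS leq_addl.
have cvs w : (fun n => fine (s n w)) @ \oo --> h w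
  by exact: (cvg_fine_sup (nds w) (Sfin w)).
have rE n w : fine (reduced (D n) w) = (psi w - fine (s n w))%R.
  have := congr1 fine (sr n w); rewrite fineD ?reduced_fin//=.
    by move=> <-; rewrite addrC addKr.
  by rewrite fin_numB reduced_fin.
have cvr w : (fun n => fine (reduced (D n) w)) @ \oo --> (psi w - h w)%R.
  under eq_fun do rewrite rE.
  by apply: cvgB => //; exact: cvg_cst.
have bah : (b * (psi v0 - h v0) <= a * (psi v - h v))%R.
  apply: (@ler_cvg_to _ \oo _ _ (fun n => b * fine (reduced (D n) v0))%R
    (fun n => a * fine (reduced (D n) v))%R); [exact: cvgMl_tmp|exact: cvgMl_tmp|].
  by apply: nearW => n; apply: reduced_half_space => w [].
have h1 : h v0 = 1%R.
  have hle : (h v0 <= 1)%R by rewrite -lee_fin hS -psi_v0.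
  apply/eqP; rewrite eq_le hle /= leNgt; apply/negP => hlt.
  (* Since [h] is [h v0] times [psi], [bah] reads [b (1 - h v0) <= a psi(v) (1 - h v0)], which
     contradicts [a psi(v) < b] when [h v0 < 1]. *)
  move: bah; rewrite psi_v0 (hP v); apply/negP; rewrite -ltNge.
  have -> : (a * (psi v - h v0 * psi v) = (a * psi v) * (1 - h v0))%R by ring.
  by rewrite ltr_pM2r// subr_gt0.
have /cvgrPdist_le/(_ _ e0)[N _ /(_ N (leqnn N))] := cvr v0.
rewrite psi_v0 h1 subrr sub0r normrN => he; exists N.
rewrite -[leLHS]fineK ?reduced_fin// lee_fin; exact: le_trans (ler_norm _) he.
Qed.

End Reduced.
End Operator.

(** An injective sequence meets a finite set at finitely many indices only. *)
Lemma initial_segment_eventually (V : countType) (t : nat -> V) n : injective t ->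
  \forall i \near \oo, ~ initial_segment n (t i).
Proof.
move=> injt; have /finite_seqP[s sE] : finite_set (t @^-1` initial_segment n).
  by apply: finite_preimage; [move=> i j _ _;
    exact: injt|exact: finite_initial_segment].
exists (\max_(i <- s) i).+1 => // i /= lti ti.
have is_ : i \in s by have : (t @^-1` initial_segment n) i by []; rewrite sE.
by move: lti; rewrite ltnNge (leq_bigmax_seq i).
Qed.

(** * The kernel of a non-negative matrix *)

Section Harmonic.
Context (R : realType) (V : countType) (A : V -> V -> R) (beta : R).
Hypothesis A0 : nonneg_mx A.

Definition scaled_mx v w : R := expR (- beta) * A v w.

Lemma scaled_mx_ge0 v w : 0 <= scaled_mx v w.
Proof. by rewrite mulr_ge0// expR_ge0. Qed.

Lemma kop_scaled_mx (f : V -> \bar R) v : (forall w, 0 <= f w)%E ->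
  kop scaled_mx f v = ((expR (- beta))%:E * kop A f v)%E.
Proof.
move=> f0; rewrite -kopZ ?expR_ge0//; apply: eq_esum => w _.
by rewrite /scaled_mx EFinM -muleA muleCA.
Qed.

Lemma harmonic_kop (h : V -> R) v : (forall w, 0 <= h w) ->
  \esum_(w in [set: V]) (A v w * h w)%:E = (expR beta * h v)%:E <->
  kop scaled_mx (EFin \o h) v = (h v)%:E.
Proof.
move=> h0; rewrite kop_scaled_mx//; split=> [hE|hE].
  rewrite (_ : kop A _ v = (expR beta * h v)%:E).
    by rewrite -EFinM mulrA -expRD addNr expR0 mul1r.
  by rewrite -hE; apply: eq_esum => w _; rewrite EFinM.
rewrite EFinM -hE muleA -EFinM -expRD subrr expR0 mul1e.
by apply: eq_esum => w _; rewrite EFinM.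
Qed.

Lemma mxpow_ge0 n v w : (0 <= mxpow A n v w)%E.
Proof.
elim: n v => [|n IH] v /=; first by rewrite lee_fin.
by apply: esum_ge0 => u _; rewrite mule_ge0// lee_fin.
Qed.

(** Each iteration contributes one factor [e^(-beta)]; this identifies [green] with the Green kernel
    of [scaled_mx]. *)
Lemma mxpow_iter n v w : (mxpow A n v w * (expR (- (n%:R * beta)))%:E)%E =
  iter n (kop scaled_mx) (dirac_at R w) v.
Proof.
elim: n v => [|n IH] v; first by rewrite mul0r oppr0 expR0 mule1.
rewrite iterS -(eq_kop _ _ IH) kop_scaled_mx; last first.
  by move=> u; rewrite mule_ge0 ?mxpow_ge0// lee_fin expR_ge0.
have -> : kop A (fun u => mxpow A n u w * (expR (- (n%:R * beta)))%:E)%E v =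
    ((expR (- (n%:R * beta)))%:E * mxpow A n.+1 v w)%E.
  rewrite -[mxpow A n.+1 v w]/(kop A (mxpow A n ^~ w) v) -kopZ ?expR_ge0//.
    by apply: eq_kop => u; rewrite muleC.
  by move=> u; exact: mxpow_ge0.
by rewrite muleA -EFinM -expRD muleC -opprD -[in LHS]natr1 mulrDl mul1r addrC.
Qed.

Lemma greenE v w : green A beta v w = greenk scaled_mx v w.
Proof. by apply: eq_eseriesr => n _; exact: mxpow_iter. Qed.

(** With [c = h v0], [psi] is the midpoint of [psi + (h - c psi)] and [psi - (h - c psi)]. Both are
    harmonic, and normalized because [h - c psi] vanishes at [v0]; extremality gives [h = c psi]. *)
Lemma extremal_minimal (v0 : V) (psi : V -> R) : (forall v, 0 <= psi v) ->
  (forall v, kop scaled_mx (EFin \o psi) v = (psi v)%:E) ->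
  extreme_point (normalized_almost_harmonic A beta v0) psi ->
  forall h : V -> R, (forall v, 0 <= h v <= psi v) ->
  (forall v, kop scaled_mx (EFin \o h) v = (h v)%:E) ->
  forall v, h v = h v0 * psi v.
Proof.
move=> psi0 Ppsi [[_ psi_v0] ext] h h0psi Ph.
have h0 v : 0 <= h v by have /andP[] := h0psi v.
have hpsi v : h v <= psi v by have /andP[] := h0psi v.
pose c := h v0; have c0 : 0 <= c by exact: h0.
have c1 : c <= 1 by rewrite -psi_v0; exact: hpsi.
pose y : V -> R^o := fun v => (1 - c) * psi v + h v.
pose z : V -> R^o := fun v => (1 + c) * psi v - h v.
have y0 v : 0 <= y v by rewrite addr_ge0// mulr_ge0// subr_ge0.
(* Here [h <= psi <= (1 + c) psi]. *)
have z0 v : 0 <= z v.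
  by rewrite subr_ge0; apply: le_trans (hpsi v) _; rewrite ler_peMl// lerDl.
have E0 (f : V -> R) : (forall v, 0 <= f v) -> forall v, (0 <= (EFin \o f) v)%E.
  by move=> f0 v; rewrite lee_fin.
have PZ d v : 0 <= d -> kop scaled_mx (fun v => d%:E * (EFin \o psi) v)%E v =
    (d * psi v)%:E.
  by move=> d0; rewrite (kopZ scaled_mx_ge0)// Ppsi.
have Py v : kop scaled_mx (EFin \o y) v = (y v)%:E.
  rewrite EFinD -PZ ?subr_ge0// -Ph -(kopD scaled_mx_ge0).
  - by apply: eq_kop => w; rewrite /= -EFinM -EFinD.
  - by move=> w; rewrite mule_ge0 ?lee_fin// subr_ge0.
  - exact: E0.
(* [kopD] concerns sums of non-negative functions, so [h] is added to both sides and then cancelled,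
   being finite. *)
have Pz v : kop scaled_mx (EFin \o z) v = (z v)%:E.
  have : (kop scaled_mx (EFin \o z) v + (h v)%:E = (z v)%:E + (h v)%:E)%E.
    rewrite -EFinD subrK -PZ ?addr_ge0// -Ph -(kopD scaled_mx_ge0); [|exact: E0..].
    by apply: eq_kop => w; rewrite /= -EFinM -EFinD subrK.
  by move=> /(congr1 (fun x => x - (h v)%:E)%E); rewrite !addeK.
have harm (f : V -> R^o) : (forall v, 0 <= f v) ->
    (forall v, kop scaled_mx (EFin \o f) v = (f v)%:E) -> f v0 = 1 ->
    normalized_almost_harmonic A beta v0 f.
  move=> f0 Pf f1; split=> //; split=> // v _; first exact/harmonic_kop.
  by rewrite (harmonic_kop v f0).2.
have [||||yE _] := ext y z 2^-1.
- by apply: harm => //; rewrite /y psi_v0 mulr1 subrK.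
- by apply: harm => //; rewrite /z psi_v0 mulr1 addrK.
- by lra.
- apply/funext => v.
  change (psi v = 2^-1 * ((1 - c) * psi v + h v) +
    (1 - 2^-1) * ((1 + c) * psi v - h v)); lra.
by move=> v; have := congr1 (fun f => f v) yE; rewrite /y -/c => hE; lra.
Qed.

End Harmonic.

(** * Construction of the path and convergence of the quotients *)

Theorem theorem4p12 (R : realType) (V : countType) (A : V -> V -> R)
  (A_nonneg : nonneg_mx A)
  (A_cofinal : cofinal A)
  (A_rows : no_zero_row A)
  (A_powers : forall n v w, (mxpow A n v w < +oo)%E)
  (A_beta0 : forall v, NW A v -> (beta0 A v < +oo)%E)
  (beta : R) (v0 : V)
  (green_fin : forall v w, (green A beta v w < +oo)%E)
  (psi : V -> R)
  (psi_neq0 : exists v, psi v != 0)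
  (psi_harmonic : harmonic_vector A beta psi)
  (psi_v0 : psi v0 = 1)
  (psi_extremal : extreme_point (normalized_almost_harmonic A beta v0) psi) :
  exists t : nat -> V,
    [/\ infinite_paths A t,
        t 0%N = v0,
        forall i j : nat, i <> j -> t i <> t j
      & forall v : V,
          (fun k => fine (green A beta v (t k)) / fine (green A beta v0 (t k)))
            @ \oo --> psi v].
Proof.
pose p := scaled_mx A beta; have p0 := scaled_mx_ge0 beta A_nonneg.
have [psi0 psiA] := psi_harmonic.
have psiP v : kop p (EFin \o psi) v = (psi v)%:E.
  by apply/(harmonic_kop beta A_nonneg v psi0).
have psi_min := extremal_minimal A_nonneg psi0 psiP psi_extremal.
have gfin v w : (greenk p v w < +oo)%E by rewrite -greenE.
pose G v w := fine (greenk p v w).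
(* The sign [s] selects the side of the error: [B v k false] holds the [w] with
   [G v w >= (psi v + 1/(k+1)) G v0 w], and [B v k true] those with
   [G v w <= (psi v - 1/(k+1)) G v0 w]. *)
pose a (s : bool) : R := (-1) ^+ s.
pose b (v : V) (k : nat) (s : bool) := a s * psi v + k.+1%:R^-1.
pose B v k s := [set w | b v k s * G v0 w <= a s * G v w].
(* The triples [(v, k, s)] are enumerated by [unpickle]; numbers that code no triple get the empty
   set. *)
have /choice[C CP] : forall j, exists D : set V,
    (reduced p psi D v0 <= (2^-1 / (2 ^ j.+1)%:R)%:E)%E /\
    forall v k s, unpickle j = Some (v, k, s) ->
      exists n, B v k s `\` initial_segment n `<=` D.
  move=> j.
  have e0 : 0 < 2^-1 / (2 ^ j.+1)%:R :> R by rewrite divr_gt0// ltr0n expn_gt0.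
  case: (unpickle j) => [[[v k] s]|]; last first.
    by exists set0; split=> //; rewrite reduced0// lee_fin ltW.
  have [|n nP] := reduced_tail p0 psi0 psiP gfin psi_v0 psi_min (a := a s) (b :=
    b v k s) (v := v) _ e0.
    by rewrite /b ltrDl invr_gt0 ltr0n.
  exists (B v k s `\` initial_segment n); split=> // _ _ _ [<- <- <-].
  by exists n.
have Cv0 : (reduced p psi (\bigcup_j C j) v0 < (psi v0)%:E)%E.
  (* The geometric bounds add up to at most [1/2 < 1 = psi v0]. *)
  apply: (@le_lt_trans _ _ (2^-1)%:E).
    by apply: reduced_bigcup_geometric => // j; exact: (CP j).1.
  by rewrite psi_v0 lte_fin invf_lt1// ltr1n.
have [t [t0 pt injt Ct]] := reduced_avoid_path p0 psi0 psiP gfin Cv0.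
exists t; split=> //.
- move=> i; have := pt i; rewrite /p /scaled_mx pmulr_rgt0// expR_gt0//.
- by move=> i j ij /injt.
move=> v; apply/cvgrPdist_lt => e e0.
have [k ke] : exists k, k.+1%:R^-1 < e.
  have [k _ /(_ k (leqnn k))] := near_infty_natSinv_lt (PosNum e0).
  by exists k.
(* The path misses [B] outside some initial segment, and it eventually leaves that segment. *)
have avoid s : \forall i \near \oo, ~ B v k s (t i).
  have [n Bn] := (CP (pickle (v, k, s))).2 v k s (pickleK _).
  near=> i => Bi; apply: (Ct i); exists (pickle (v, k, s)) => //.
  by apply: Bn; split=> //; near: i; exact: initial_segment_eventually.
have Bt := avoid true; have Bf := avoid false.
near=> i; rewrite !greenE -/p -/(G v (t i)) -/(G v0 (t i)).
have /negP : ~ B v k true (t i) by near: i.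
have /negP : ~ B v k false (t i) by near: i.
rewrite -!ltNge /b /a /= expr0 expr1 !mul1r !mulN1r.
set d := k.+1%:R^-1; set g := G v (t i); set g0 := G v0 (t i) => lt1 lt2.
have d0 : 0 < d by rewrite invr_gt0 ltr0n.
(* Adding the two strict inequalities gives [0 < 2 d g0]. *)
have g00 : 0 < g0 by nra.
apply: le_lt_trans ke; rewrite -/d ler_norml.
have -> : psi v - g / g0 = (psi v * g0 - g) / g0 by field; rewrite gt_eqF.
by rewrite ler_pdivlMr// ler_pdivrMr//; apply/andP; split; nra.
Unshelve. all: by end_near.
Qed.
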